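(* For positive integers $m$ and $n$: (i) $\frac{2n+1}{2m+1}\in\mathbb{Z}$ if and only if $P_n(x)/P_m(x)\in\mathbb{Z}[x]$, and if and only if $P^{\rm Inv}_n(x)/P^{\rm Inv}_m(x)\in\mathbb{Z}[x]$; (ii) $n/m$ is an odd integer if and only if $Q_n(x)/Q_m(x)\in\mathbb{Z}[x]$, and if and only if $Q^{\rm Inv}_n(x)/Q^{\rm Inv}_m(x)\in\mathbb{Z}[x]$; (iii) for every positive integer $a$, $\frac{2n+1}{2m+1}\in\mathbb{Z}$ if and only if $\frac{(a+1)^{2n+1}-a^{2n+1}}{(a+1)^{2m+1}-a^{2m+1}}\in\mathbb{N}$; (iv) for every positive integer $a$, $n/m$ is an odd integer if and only if $\frac{(a+1)^{2n}+a^{2n}}{(a+1)^{2m}+a^{2m}}\in\mathbb{N}$.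
   Context: For integers $n,k\ge0$: $T_k(n)=\binom{n+k+1}{2k+1}+\binom{n+k}{2k+1}$, $U_k(n)=\binom{n+k}{2k}+\binom{n+k-1}{2k}$ for $k\ge1$, $U_0(n)=2$. $P_n(x)=\sum_{k=0}^nT_k(n)x^k$, $Q_n(x)=\sum_{k=0}^nU_k(n)x^k$, $P^{\rm Inv}_n(x)=x^nP_n(1/x)$, $Q^{\rm Inv}_n(x)=x^nQ_n(1/x)$. *)

(* Defs.v *)
From HB Require Import structures.
From mathcomp Require Import all_boot all_order all_algebra.

Set Implicit Arguments.
Unset Strict Implicit.
Unset Printing Implicit Defensive.

Import Order.TTheory GRing.Theory Num.Theory.

Local Open Scope ring_scope.

Definition T (k n : nat) : nat :=
  ('C(n + k + 1, 2 * k + 1) + 'C(n + k, 2 * k + 1))%N.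

(* The truncated subtraction is only reached for k >= 1, so it is exact. *)
Definition U (k n : nat) : nat :=
  if k == 0%N then 2%N else ('C(n + k, 2 * k) + 'C(n + k - 1, 2 * k))%N.

Definition P (n : nat) : {poly int} := \sum_(k < n.+1) (T k n)%:R *: 'X^k.

Definition Q (n : nat) : {poly int} := \sum_(k < n.+1) (U k n)%:R *: 'X^k.

(* Z(x), as the fraction field of Z[x]. *)
Notation ratfun := {fraction {poly int}}.

Definition ratfun_of_poly (p : {poly int}) : ratfun := tofrac p.

(* x^n p(1/x), evaluated in Z(x). *)
Definition inv_poly (n : nat) (p : {poly int}) : ratfun :=
  let x := ratfun_of_poly 'X in
  x ^+ n * (map_poly (intr : int -> ratfun) p).[x^-1].

Definition P_inv (n : nat) : ratfun := inv_poly n (P n).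

Definition Q_inv (n : nat) : ratfun := inv_poly n (Q n).

Definition in_Zx (f : ratfun) : Prop :=
  exists s : {poly int}, f = ratfun_of_poly s.

Definition is_odd_integer (q : rat) : Prop :=
  exists k : int, q = (2 * k + 1)%:~R.

(* Main.v *)
(** Homogenized, P_n and Q_n solve f(n+2) = (x + 2y) f(n+1) - y^2 f(n); with
    x = (b - a)^2 and y = a b they are (b^(2n+1) - a^(2n+1)) / (b - a) and
    b^(2n) + a^(2n).  The choices (X, 1), (1, X) and (1, a(a+1)) of (x, y) give
    P_n, P_n^Inv and (a+1)^(2n+1) - a^(2n+1), and likewise for Q_n.
    Every solution f satisfies
      f(n+2k) + y^(2k) f(n) = Q_k f(n+k),
      f(n+2k+1) - y^(2k+1) f(n) = P_k (f(n+k+1) - y f(n+k)),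
    which yields the divisibilities in any commutative ring.  Conversely,
    evaluating polynomials at 1 reduces everything to integers with x = 1 and
    y > 0.  There P_m and Q_m are coprime to y, so the same identities lower
    the index n below m, where the values are positive and too small to be
    multiples. *)

Require Import Defs.
From HB Require Import structures.
From mathcomp Require Import all_boot all_order all_algebra.
From mathcomp Require Import ring zify.

Set Implicit Arguments.
Unset Strict Implicit.
Unset Printing Implicit Defensive.

Import Order.TTheory GRing.Theory Num.Theory.

Local Open Scope ring_scope.

(** * The homogeneous recurrence over a commutative ring *)

Fixpoint linrec (R : comNzRingType) (s t f0 f1 : R) (n : nat) : R :=
  if n is n'.+1 then linrec s t f1 (s * f1 - t * f0) n' else f0.

Definition hrec (R : comNzRingType) (x y f0 f1 : R) : nat -> R :=
  linrec (x + 2 * y) (y ^+ 2) f0 f1.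

Definition hP (R : comNzRingType) (x y : R) := hrec x y 1 (x + 3 * y).

Definition hQ (R : comNzRingType) (x y : R) := hrec x y 2 (x + 2 * y).

Lemma two_step_ind (A : nat -> Prop) :
  A 0 -> A 1 -> (forall n, A n -> A n.+1 -> A n.+2) -> forall n, A n.
Proof.
move=> A0 A1 AS n; suff [] : A n /\ A n.+1 by [].
by elim: n => [|n [An An1]]; split => //; apply: AS.
Qed.

(** [linrec] moves the pair of initial values forward, so the induction must keep [f0] and [f1]
    general. *)
Lemma hrecSS (R : comNzRingType) (x y f0 f1 : R) n :
  hrec x y f0 f1 n.+2 =
  (x + 2 * y) * hrec x y f0 f1 n.+1 - y ^+ 2 * hrec x y f0 f1 n.
Proof. by rewrite /hrec; elim: n f0 f1 => [//|n IHn] f0 f1; apply: IHn. Qed.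

Section HomogeneousRecurrence.

Variables (R : comNzRingType) (x y : R).

Lemma hPSS n : hP x y n.+2 = (x + 2 * y) * hP x y n.+1 - y ^+ 2 * hP x y n.
Proof. exact: hrecSS. Qed.

Lemma hQSS n : hQ x y n.+2 = (x + 2 * y) * hQ x y n.+1 - y ^+ 2 * hQ x y n.
Proof. exact: hrecSS. Qed.

(** The characteristic roots a^2, b^2 have product y^2. Expanding (a^(2k) + b^(2k)) (A a^(2n+2k) + B
    b^(2n+2k)) leaves the cross terms y^(2k) f(n). The induction on [k] replays this without
    roots. *)
Lemma hrec_shift_even (f0 f1 : R) (f := hrec x y f0 f1) k n :
  f (n + 2 * k)%N + y ^+ (2 * k) * f n = hQ x y k * f (n + k)%N.
Proof.
move: k n; apply: two_step_ind => [n|n|k IHk IHk1 n].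
- by rewrite muln0 addn0 expr0 /hQ /hrec /=; ring.
- by rewrite muln1 addn2 addn1 /f hrecSS /hQ /hrec /=; ring.
rewrite hQSS mulrBl -[_ * hQ x y k.+1 * _]mulrA -[_ * hQ x y k * _]mulrA.
(* The same index is also (n+2) + k, so the two hypotheses apply at n+1 and n+2. *)
have -> : (n + k.+2 = n.+1 + k.+1)%N by lia.
rewrite -IHk1.
have -> : (n.+1 + k.+1 = n.+2 + k)%N by lia.
rewrite -IHk.
have -> : (n + 2 * k.+2 = (n.+2 + 2 * k).+2)%N by lia.
have -> : (n.+1 + 2 * k.+1 = (n.+2 + 2 * k).+1)%N by lia.
rewrite /f hrecSS -/f.
have -> : (2 * k.+2 = (2 * k).+4)%N by lia.
have -> : (2 * k.+1 = (2 * k).+2)%N by lia.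
rewrite /f (hrecSS x y f0 f1 n) -/f !exprS; ring.
Qed.

(** In terms of roots, f(n+k+1) - y f(n+k) is (b - a) (B b^(2n+2k+1) - A a^(2n+2k+1)), and b - a
    cancels the denominator of P_k. *)
Lemma hrec_shift_odd (f0 f1 : R) (f := hrec x y f0 f1) k n :
  f (n + 2 * k + 1)%N - y ^+ (2 * k + 1) * f n =
  hP x y k * (f (n + k).+1 - y * f (n + k)%N).
Proof.
move: k n; apply: two_step_ind => [n|n|k IHk IHk1 n].
- by rewrite muln0 !addn0 addn1 /hP /hrec /=; ring.
- rewrite muln1 addn2 !addn1 /f (hrecSS x y f0 f1 n.+1) (hrecSS x y f0 f1 n) /hP /hrec /=.
  by rewrite -/(hrec _ _ _ _); ring.
rewrite hPSS mulrBl -[_ * hP x y k.+1 * _]mulrA -[_ * hP x y k * _]mulrA.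
have -> : (n + k.+2 = n.+1 + k.+1)%N by lia.
rewrite -IHk1.
have -> : (n.+1 + k.+1 = n.+2 + k)%N by lia.
rewrite -IHk.
have -> : (n + 2 * k.+2 + 1 = (n.+2 + 2 * k + 1).+2)%N by lia.
have -> : (n.+1 + 2 * k.+1 + 1 = (n.+2 + 2 * k + 1).+1)%N by lia.
rewrite /f hrecSS -/f.
have -> : (2 * k.+2 + 1 = (2 * k + 1).+4)%N by lia.
have -> : (2 * k.+1 + 1 = (2 * k + 1).+2)%N by lia.
rewrite /f (hrecSS x y f0 f1 n) -/f !exprS; ring.
Qed.

(** Each odd shift with k = m adds 2m+1 to the index, so 2n+1 runs through the odd multiples
    (2j+1)(2m+1). *)
Lemma hP_dvd m j :
  exists q, hP x y (m + j * (2 * m + 1))%N = q * hP x y m.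
Proof.
elim: j => [|j [q Eq]]; first by exists 1; rewrite mul0n addn0 mul1r.
set n := (m + j * (2 * m + 1))%N in Eq.
have /eqP := hrec_shift_odd 1 (x + 3 * y) m n.
rewrite subr_eq -/(hP x y) => /eqP E.
exists (hP x y (n + m).+1 - y * hP x y (n + m) + y ^+ (2 * m + 1) * q).
have -> : (m + j.+1 * (2 * m + 1) = n + 2 * m + 1)%N by rewrite /n; lia.
by rewrite E Eq; ring.
Qed.

Lemma hQ_dvd m j :
  exists q, hQ x y (m * (2 * j + 1))%N = q * hQ x y m.
Proof.
elim: j => [|j [q Eq]]; first by exists 1; rewrite muln1 mul1r.
set n := (m * (2 * j + 1))%N in Eq.
have E := hrec_shift_even 2 (x + 2 * y) m n; rewrite -/(hQ x y) in E.
exists (hQ x y (n + m) - y ^+ (2 * m) * q).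
have -> : (m * (2 * j.+1 + 1) = n + 2 * m)%N by rewrite /n; lia.
by rewrite mulrBl [hQ x y (n + m) * _]mulrC -E -mulrA -Eq addrK.
Qed.

(** The n-th term is homogeneous of degree n once [f0] and [f1] have degrees 0 and 1. *)
Lemma hrecZ (c f0 f1 : R) n :
  hrec (c * x) (c * y) f0 (c * f1) n = c ^+ n * hrec x y f0 f1 n.
Proof.
move: n; apply: two_step_ind => [|//|n IHn IHn1].
  by rewrite expr0 mul1r.
by rewrite !hrecSS IHn IHn1 !exprS; ring.
Qed.

Lemma hPZ (c : R) n : hP (c * x) (c * y) n = c ^+ n * hP x y n.
Proof. by rewrite /hP -hrecZ mulrDr (mulrCA c). Qed.

Lemma hQZ (c : R) n : hQ (c * x) (c * y) n = c ^+ n * hQ x y n.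
Proof. by rewrite /hQ -hrecZ mulrDr (mulrCA c). Qed.

End HomogeneousRecurrence.

(** The factor b - a stays on the left because the ring has no division. *)
Lemma hP_powers (R : comNzRingType) (a b : R) n :
  (b - a) * hP ((b - a) ^+ 2) (a * b) n = b ^+ (2 * n + 1) - a ^+ (2 * n + 1).
Proof.
move: n; apply: two_step_ind => [||n IHn IHn1].
- by rewrite /hP /hrec /= !expr1 mulr1.
- by rewrite /hP /hrec /=; ring.
rewrite hPSS mulrBr !(mulrCA (b - a)) IHn IHn1.
have -> : (2 * n.+2 + 1 = (2 * n + 1).+4)%N by lia.
have -> : (2 * n.+1 + 1 = (2 * n + 1).+2)%N by lia.
by rewrite !exprS; ring.
Qed.

Lemma hQ_powers (R : comNzRingType) (a b : R) n :
  hQ ((b - a) ^+ 2) (a * b) n = b ^+ (2 * n) + a ^+ (2 * n).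
Proof.
move: n; apply: two_step_ind => [||n IHn IHn1].
- by rewrite /hQ /hrec /= !expr0.
- by rewrite /hQ /hrec /=; ring.
rewrite hQSS IHn IHn1.
have -> : (2 * n.+2 = (2 * n).+4)%N by lia.
have -> : (2 * n.+1 = (2 * n).+2)%N by lia.
by rewrite !exprS; ring.
Qed.

(** * Compatibility with ring morphisms *)

Section Morphism.

Variables (R S : comNzRingType) (phi : {rmorphism R -> S}) (x y : R).

Lemma rmorph_lin k : phi (x + k%:R * y) = phi x + k%:R * phi y.
Proof. by rewrite rmorphD rmorphM rmorph_nat. Qed.

Lemma rmorph_hrec f0 f1 n :
  phi (hrec x y f0 f1 n) = hrec (phi x) (phi y) (phi f0) (phi f1) n.
Proof.
move: n; apply: two_step_ind => [//|//|n IHn IHn1].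
by rewrite !hrecSS rmorphB rmorphM rmorph_lin rmorphM rmorphXn IHn IHn1.
Qed.

Lemma rmorph_hP n : phi (hP x y n) = hP (phi x) (phi y) n.
Proof. by rewrite /hP rmorph_hrec rmorph1 rmorph_lin. Qed.

Lemma rmorph_hQ n : phi (hQ x y n) = hQ (phi x) (phi y) n.
Proof. by rewrite /hQ rmorph_hrec rmorph_nat rmorph_lin. Qed.

End Morphism.

(** * Necessary conditions over the integers, with x = 1 and y > 0 *)

Section Integers.

Variable y : int.
Hypothesis y_gt0 : 0 < y.

Section Growth.

Variables f0 f1 : int.
Hypotheses (f0_gt0 : 0 < f0) (f01 : f0 < f1) (yf01 : y * f0 <= f1).
Let f := hrec 1 y f0 f1.

(** The third bound drives the induction: y^2 f(n) <= y f(n+1) gives f(n+2) >= (1+y) f(n+1). *)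
Lemma hrec_growth n : [/\ 0 < f n, f n < f n.+1 & y * f n <= f n.+1].
Proof.
elim: n => [//|n [f_gt0 f_lt yf_le]].
have E : f n.+2 = (1 + 2 * y) * f n.+1 - y ^+ 2 * f n by exact: hrecSS.
rewrite E; split; nia.
Qed.

Lemma hrec_gt0 n : 0 < f n.
Proof. by case: (hrec_growth n). Qed.

Lemma hrec_lt i j : (i < j)%N -> f i < f j.
Proof.
elim: j => [//|j IHj]; rewrite ltnS leq_eqVlt => /orP[/eqP->|/IHj lt_ij].
  by case: (hrec_growth j).
by apply: lt_trans lt_ij _; case: (hrec_growth j).
Qed.

Lemma hrec_dvd_leq m n : (f m %| f n)%Z -> (m <= n)%N.
Proof.
move=> dvd_mn; rewrite leqNgt; apply/negP => /hrec_lt lt_nm.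
have := hrec_gt0 n; move: lt_nm; case/dvdzP: dvd_mn => q ->.
by rewrite gtr_pMl ?pmulr_lgt0 ?hrec_gt0 //; lia.
Qed.

Hypothesis f1_mod : (y %| f1 - 1)%Z.

(** Modulo y the recurrence reads f(n+2) = f(n+1), so every term from index 1 on is 1. Index 0 is
    left out since Q_0 = 2. *)
Lemma hrec_coprime n j : coprimez (f n.+1) (y ^+ j).
Proof.
have [w Ew] : exists w, f n.+1 = 1 + y * w.
  elim: n => [|n [w Ew]].
    by case/dvdzP: f1_mod => w E; exists w; rewrite mulrC -E addrC subrK.
  exists (w + 2 * f n.+1 - y * f n).
  have -> : f n.+2 = (1 + 2 * y) * f n.+1 - y ^+ 2 * f n by exact: hrecSS.
  by rewrite Ew; ring.
rewrite coprimez_sym; apply: coprimezXl; apply/coprimezP.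
by exists (- w, 1) => /=; rewrite Ew; ring.
Qed.

Lemma hrec_dvd_cancel n j z : (0 < n)%N ->
  (f n %| y ^+ j * z)%Z = (f n %| z)%Z.
Proof. by case: n => [//|n] _; apply: Gauss_dvdzr; apply: hrec_coprime. Qed.

End Growth.

Lemma hP_dvdz m n : (0 < m)%N ->
  (hP 1 y m %| hP 1 y n)%Z -> (2 * m + 1 %| 2 * n + 1)%N.
Proof.
move=> m_gt0; have [n' le_nn'] := ubnP n.
elim: n' n le_nn' => // n' IHn n lt_nn' dvd_mn.
have y3 : (1 : int) < 1 + 3 * y by lia.
have yle : y * 1 <= 1 + 3 * y by lia.
have ymod : (y %| 1 + 3 * y - 1)%Z by rewrite addrC addKr dvdz_mull.
have le_mn := hrec_dvd_leq ltr01 y3 yle dvd_mn.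
have cancel j z := hrec_dvd_cancel 1 ymod j z m_gt0.
have [le_n2m|lt_2mn] := leqP n (2 * m).
  have [->//|neq_nm] := eqVneq n m.
  (* Reflection of n in m: the even shift from 2m-n by n-m is centred at m, and the power of y
     cancels by coprimality. *)
  have : (hP 1 y m %| hP 1 y (2 * m - n))%Z.
    rewrite -(cancel (2 * (n - m))%N) -(rpredDl _ dvd_mn).
    have := hrec_shift_even 1 y 1 (1 + 3 * y) (n - m) (2 * m - n).
    have -> : (2 * m - n + 2 * (n - m) = n)%N by lia.
    have -> : (2 * m - n + (n - m) = m)%N by lia.
    by move=> ->; rewrite dvdz_mull.
  move=> /IHn -/(_ ltac:(lia)) dvd_r.
  rewrite -(dvdn_addl _ dvd_r).
  have -> : (2 * n + 1 + (2 * (2 * m - n) + 1) = 2 * (2 * m + 1))%N by lia.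
  exact: dvdn_mull.
(* Translation: the odd shift with k = m has the factor P_m. *)
have : (hP 1 y m %| hP 1 y (n - (2 * m + 1)))%Z.
  rewrite -(cancel (2 * m + 1)%N) -(rpredBl _ dvd_mn).
  have := hrec_shift_odd 1 y 1 (1 + 3 * y) m (n - (2 * m + 1)).
  have -> : (n - (2 * m + 1) + 2 * m + 1 = n)%N by lia.
  by move=> ->; rewrite dvdz_mulr.
move=> /IHn -/(_ ltac:(lia)) dvd_r.
have -> : (2 * n + 1 = 2 * (2 * m + 1) + (2 * (n - (2 * m + 1)) + 1))%N by lia.
by rewrite dvdn_add // dvdn_mull.
Qed.

Lemma hQ_dvdz m n : (0 < m)%N ->
  (hQ 1 y m %| hQ 1 y n)%Z -> exists j, n = (m * (2 * j + 1))%N.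
Proof.
move=> m_gt0; have [n' le_nn'] := ubnP n.
elim: n' n le_nn' => // n' IHn n lt_nn' dvd_mn.
have y3 : (2 : int) < 1 + 2 * y by lia.
have yle : y * 2 <= 1 + 2 * y by lia.
have ymod : (y %| 1 + 2 * y - 1)%Z by rewrite addrC addKr dvdz_mull.
have le_mn := hrec_dvd_leq (ltr0Sn _ 1) y3 yle dvd_mn.
have cancel j z := hrec_dvd_cancel 2 ymod j z m_gt0.
have [->|neq_nm] := eqVneq n m; first by exists 0%N; rewrite muln1.
have [le_n2m|lt_2mn] := leqP n (2 * m).
  (* The reflected index lies below m, which the growth bound forbids. *)
  have : (hQ 1 y m %| hQ 1 y (2 * m - n))%Z.
    rewrite -(cancel (2 * (n - m))%N) -(rpredDl _ dvd_mn).
    have := hrec_shift_even 1 y 2 (1 + 2 * y) (n - m) (2 * m - n).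
    have -> : (2 * m - n + 2 * (n - m) = n)%N by lia.
    have -> : (2 * m - n + (n - m) = m)%N by lia.
    by move=> ->; rewrite dvdz_mull.
  by move=> /(hrec_dvd_leq (ltr0Sn _ 1) y3 yle); lia.
have : (hQ 1 y m %| hQ 1 y (n - 2 * m))%Z.
  rewrite -(cancel (2 * m)%N) -(rpredDl _ dvd_mn).
  have := hrec_shift_even 1 y 2 (1 + 2 * y) m (n - 2 * m).
  have -> : (n - 2 * m + 2 * m = n)%N by lia.
  by move=> ->; rewrite dvdz_mulr.
move=> /IHn -/(_ ltac:(lia)) [j Ej].
by exists j.+1; lia.
Qed.

Lemma hP_gt0 n : 0 < hP 1 y n.
Proof. by apply: hrec_gt0; lia. Qed.

Lemma hQ_gt0 n : 0 < hQ 1 y n.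
Proof. by apply: hrec_gt0; lia. Qed.

End Integers.

(** * From quotients to divisibility *)

Lemma in_ZxP (p d : {poly int}) : d != 0 ->
  in_Zx (ratfun_of_poly p / ratfun_of_poly d) <-> exists q, p = q * d.
Proof.
move=> d_neq0; rewrite /in_Zx /ratfun_of_poly.
have d'_neq0 : tofrac d != 0 by rewrite tofrac_eq0.
split=> [[q Eq]|[q ->]]; exists q; last by rewrite tofracM mulfK.
apply/eqP; rewrite -tofrac_eq tofracM -Eq; apply/eqP; exact/esym/divfK.
Qed.

Lemma intr_div_intP (p d : int) : d != 0 ->
  ((p%:~R / d%:~R : rat) \is a Num.int) <-> exists q, p = q * d.
Proof.
move=> d_neq0; have d'_neq0 : d%:~R != 0 :> rat by rewrite intr_eq0.
split=> [/intrP[q Eq]|[q Eq]]; [exists q|apply/intrP; exists q].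
  by apply/eqP; rewrite -(eqr_int rat) intrM -Eq divfK.
by rewrite Eq intrM mulfK.
Qed.

Lemma odd_ratio_dvdn m n :
  ((2 * n + 1)%:R / (2 * m + 1)%:R : rat) \is a Num.int <->
  (2 * m + 1 %| 2 * n + 1)%N.
Proof.
rewrite !pmulrn; split=> [/intr_div_intP|/dvdnP [q Eq]].
  case=> [|q Eq]; first by lia.
  by rewrite -[(_ %| _)%N]/(Posz _ %| Posz _)%Z; apply/dvdzP; exists q.
by apply/intr_div_intP; [lia|exists q%:Z; rewrite Eq PoszM].
Qed.

Lemma is_odd_integerP m n : (0 < m)%N ->
  is_odd_integer (n%:R / m%:R) <-> exists j, n = (m * (2 * j + 1))%N.
Proof.
move=> m_gt0; have m_neq0 : m%:R != 0 :> rat by rewrite pnatr_eq0; lia.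
split=> [[k Ek]|[j ->]].
  have : (n : int) = (2 * k + 1) * m.
    by apply/eqP; rewrite -(eqr_int rat) intrM -Ek !pmulrn divfK.
  (* A negative [k] would make (2k+1)m negative. *)
  by case: k {Ek} => k Ek; [exists k|]; nia.
by exists j%:Z; rewrite natrM mulrAC divff // mul1r pmulrn PoszD PoszM.
Qed.

(** [phi] carries the converse to the integers: it will be evaluation at 1 for polynomials and the
    identity on [int]. *)
Lemma hP_dvd_iff (R : comNzRingType) (x y : R) (phi : {rmorphism R -> int}) m n :
    (0 < m)%N -> phi x = 1 -> 0 < phi y ->
  (2 * m + 1 %| 2 * n + 1)%N <-> exists q, hP x y n = q * hP x y m.
Proof.
move=> m_gt0 phix phiy; split=> [dvd_mn|[q /(congr1 phi)]].
  have [k Ek] := dvdnP dvd_mn.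
  (* A divisor of an odd number is odd, so k = 2j+1 and n = m + j(2m+1). *)
  have odd_k : odd k by have := congr1 odd Ek; rewrite oddM !addn1 /= !oddM /= andbT.
  have -> : n = (m + k./2 * (2 * m + 1))%N.
    by have := odd_double_half k; rewrite odd_k -mul2n; nia.
  exact: hP_dvd.
rewrite rmorphM !rmorph_hP phix => Eq; apply: hP_dvdz phiy _ _ m_gt0 _.
by apply/dvdzP; exists (phi q).
Qed.

Lemma hQ_dvd_iff (R : comNzRingType) (x y : R) (phi : {rmorphism R -> int}) m n :
    (0 < m)%N -> phi x = 1 -> 0 < phi y ->
  (exists j, n = (m * (2 * j + 1))%N) <-> exists q, hQ x y n = q * hQ x y m.
Proof.
move=> m_gt0 phix phiy; split=> [[j ->]|[q /(congr1 phi)]]; first exact: hQ_dvd.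
rewrite rmorphM !rmorph_hQ phix => Eq; apply: hQ_dvdz phiy _ _ m_gt0 _.
by apply/dvdzP; exists (phi q).
Qed.

Lemma hP_neq0 (R : comNzRingType) (x y : R) (phi : {rmorphism R -> int}) n :
  phi x = 1 -> 0 < phi y -> hP x y n != 0.
Proof.
move=> phix phiy; apply/eqP => /(congr1 phi)/eqP.
by rewrite rmorph_hP phix rmorph0 gt_eqF // hP_gt0.
Qed.

Lemma hQ_neq0 (R : comNzRingType) (x y : R) (phi : {rmorphism R -> int}) n :
  phi x = 1 -> 0 < phi y -> hQ x y n != 0.
Proof.
move=> phix phiy; apply/eqP => /(congr1 phi)/eqP.
by rewrite rmorph_hQ phix rmorph0 gt_eqF // hQ_gt0.
Qed.

(** * Binomial coefficients and the recurrence *)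

Lemma T_gt k n : (n < k)%N -> T k n = 0%N.
Proof. by move=> lt_nk; rewrite /T !bin_small //; lia. Qed.

Lemma U_gt k n : (n < k)%N -> U k n = 0%N.
Proof. by move=> lt_nk; rewrite /U !bin_small; (try case: eqP); lia. Qed.

Lemma T_rec0 n : (T 0 n.+2 + T 0 n = 2 * T 0 n.+1)%N.
Proof. by rewrite /T !muln0 !addn0 !bin1; lia. Qed.

(** Pascal's rule twice: a second difference in n lowers the bottom index of a binomial by 2. The
    additive form avoids truncated subtraction. *)
Lemma T_recS k n :
  (T k.+1 n.+2 + T k.+1 n = 2 * T k.+1 n.+1 + T k n.+1)%N.
Proof.
rewrite /T; have -> : (2 * k.+1 + 1 = (2 * k + 1).+2)%N by lia.
by rewrite !addnS !addSn !addn0 !binS; lia.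
Qed.

Lemma U_rec0 n : (U 0 n.+2 + U 0 n = 2 * U 0 n.+1)%N.
Proof. by []. Qed.

Lemma U_recS k n :
  (U k.+1 n.+2 + U k.+1 n = 2 * U k.+1 n.+1 + U k n.+1)%N.
Proof.
rewrite /U /=; have -> : (2 * k.+1 = (2 * k).+2)%N by lia.
(* [U 0] is 2 by convention, so k = 0 is treated apart. *)
case: k => [|k] /=; first by rewrite !addn1 !subn1 /= !binS !bin1 !bin0; lia.
by rewrite !addnS !addSn !subn1 /= !binS; lia.
Qed.

Lemma coef_P n k : (P n)`_k = (T k n)%:R.
Proof.
rewrite /P -(poly_def n.+1 (fun k => (T k n)%:R)) coef_poly ltnS.
by case: leqP => // /T_gt ->.
Qed.

Lemma coef_Q n k : (Q n)`_k = (U k n)%:R.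
Proof.
rewrite /Q -(poly_def n.+1 (fun k => (U k n)%:R)) coef_poly ltnS.
by case: leqP => // /U_gt ->.
Qed.

Lemma P_hP n : P n = hP 'X 1 n.
Proof.
move: n; apply: two_step_ind => [||n IHn IHn1].
- by apply/polyP => -[|k]; rewrite coef_P /hP /hrec /= coef1 // T_gt.
- by apply/polyP => -[|[|k]]; rewrite coef_P -[hP _ _ _]/('X + 3%:R * 1)
    mulr1 coefD coefX coefMn coef1 // T_gt.
rewrite hPSS -IHn -IHn1; apply/eqP; rewrite eq_sym subr_eq eq_sym expr1n mul1r mulr1.
apply/eqP/polyP => -[|k]; rewrite mulrDl mulr_natl !coefD coefXM /= !coef_P.
  by rewrite -natrD T_rec0; ring.
by rewrite -natrD T_recS; ring.
Qed.

Lemma Q_hQ n : Q n = hQ 'X 1 n.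
Proof.
move: n; apply: two_step_ind => [||n IHn IHn1].
- by apply/polyP => -[|k]; rewrite coef_Q /hQ /hrec /= coefMn coef1 // U_gt.
- by apply/polyP => -[|[|k]]; rewrite coef_Q -[hQ _ _ _]/('X + 2%:R * 1)
    mulr1 coefD coefX coefMn coef1 // U_gt.
rewrite hQSS -IHn -IHn1; apply/eqP; rewrite eq_sym subr_eq eq_sym expr1n mul1r mulr1.
apply/eqP/polyP => -[|k]; rewrite mulrDl mulr_natl !coefD coefXM /= !coef_Q.
  by rewrite -natrD U_rec0; ring.
by rewrite -natrD U_recS; ring.
Qed.

(** * Reciprocal polynomials and consecutive powers *)

Lemma ratfunX_neq0 : ratfun_of_poly 'X != 0.
Proof. by rewrite /ratfun_of_poly tofrac_eq0 polyX_eq0. Qed.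

(** By homogeneity, scaling the arguments (1/x, 1) by x gives (1, x) and absorbs the factor x^n. *)
Lemma P_inv_hP n : P_inv n = ratfun_of_poly (hP 1 'X n).
Proof.
rewrite /P_inv /inv_poly P_hP rmorph_hP /= map_polyX rmorph1.
rewrite -[_.[_]]/(horner_eval _ _) rmorph_hP rmorph1 /= /horner_eval hornerX -hPZ.
by rewrite mulr1 divff ?ratfunX_neq0 // /ratfun_of_poly rmorph_hP rmorph1.
Qed.

Lemma Q_inv_hQ n : Q_inv n = ratfun_of_poly (hQ 1 'X n).
Proof.
rewrite /Q_inv /inv_poly Q_hQ rmorph_hQ /= map_polyX rmorph1.
rewrite -[_.[_]]/(horner_eval _ _) rmorph_hQ rmorph1 /= /horner_eval hornerX -hQZ.
by rewrite mulr1 divff ?ratfunX_neq0 // /ratfun_of_poly rmorph_hQ rmorph1.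
Qed.

Lemma hP_consecutive (a n : nat) :
  (a + 1)%:R ^+ (2 * n + 1) - a%:R ^+ (2 * n + 1) =
  (hP 1 (a * (a + 1))%:Z n)%:~R :> rat.
Proof.
have E1 : (a + 1)%:R - a%:R = 1 :> rat by rewrite natrD addrAC subrr add0r.
by rewrite rmorph_hP rmorph1 -hP_powers E1 mul1r expr1n /= -natrM pmulrn.
Qed.

Lemma hQ_consecutive (a n : nat) :
  (a + 1)%:R ^+ (2 * n) + a%:R ^+ (2 * n) =
  (hQ 1 (a * (a + 1))%:Z n)%:~R :> rat.
Proof.
have E1 : (a + 1)%:R - a%:R = 1 :> rat by rewrite natrD addrAC subrr add0r.
by rewrite rmorph_hQ rmorph1 -hQ_powers E1 expr1n /= -natrM pmulrn.
Qed.

Lemma intr_div_nat (p d : int) : 0 < p -> 0 < d ->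
  ((p%:~R / d%:~R : rat) \is a Num.nat) = ((p%:~R / d%:~R : rat) \is a Num.int).
Proof.
by move=> p_gt0 d_gt0; rewrite natrEint divr_ge0 ?andbT // ler0z ltW.
Qed.

Theorem theorem4 (m n : nat) (hm : (0 < m)%N) (hn : (0 < n)%N) :
  [/\ (((2 * n + 1)%:R / (2 * m + 1)%:R : rat) \is a Num.int <->
         in_Zx (ratfun_of_poly (P n) / ratfun_of_poly (P m))) /\
      (((2 * n + 1)%:R / (2 * m + 1)%:R : rat) \is a Num.int <->
         in_Zx (P_inv n / P_inv m)),
      (is_odd_integer (n%:R / m%:R) <->
         in_Zx (ratfun_of_poly (Q n) / ratfun_of_poly (Q m))) /\
      (is_odd_integer (n%:R / m%:R) <->
         in_Zx (Q_inv n / Q_inv m)),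
      forall a : nat, (0 < a)%N ->
        (((2 * n + 1)%:R / (2 * m + 1)%:R : rat) \is a Num.int <->
         (((a + 1)%:R ^+ (2 * n + 1) - a%:R ^+ (2 * n + 1)) /
          ((a + 1)%:R ^+ (2 * m + 1) - a%:R ^+ (2 * m + 1)) : rat)
           \is a Num.nat)
    & forall a : nat, (0 < a)%N ->
        (is_odd_integer (n%:R / m%:R) <->
         (((a + 1)%:R ^+ (2 * n) + a%:R ^+ (2 * n)) /
          ((a + 1)%:R ^+ (2 * m) + a%:R ^+ (2 * m)) : rat)
           \is a Num.nat)].
Proof.
(* Evaluation at 1 sends both 'X and 1 to 1, so it serves for (X, 1) and (1, X) alike. *)
have ev1 : horner_eval (1 : int) 1 = 1 by rewrite /horner_eval hornerC.
have evX : horner_eval (1 : int) 'X = 1 by rewrite /horner_eval hornerX.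
have ev1_gt0 : 0 < horner_eval (1 : int) 1 by rewrite ev1.
have evX_gt0 : 0 < horner_eval (1 : int) 'X by rewrite evX.
split; [split|split|move=> a a_gt0|move=> a a_gt0].
- rewrite odd_ratio_dvdn !P_hP in_ZxP; first exact: hP_dvd_iff evX ev1_gt0.
  exact: hP_neq0 evX ev1_gt0.
- rewrite odd_ratio_dvdn !P_inv_hP in_ZxP; first exact: hP_dvd_iff ev1 evX_gt0.
  exact: hP_neq0 ev1 evX_gt0.
- rewrite is_odd_integerP // !Q_hQ in_ZxP; first exact: hQ_dvd_iff evX ev1_gt0.
  exact: hQ_neq0 evX ev1_gt0.
- rewrite is_odd_integerP // !Q_inv_hQ in_ZxP; first exact: hQ_dvd_iff ev1 evX_gt0.
  exact: hQ_neq0 ev1 evX_gt0.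
- have y_gt0 : 0 < (a * (a + 1))%:Z by nia.
  rewrite odd_ratio_dvdn !hP_consecutive intr_div_nat ?hP_gt0 //.
  rewrite intr_div_intP ?gt_eqF ?hP_gt0 //.
  exact: (@hP_dvd_iff _ _ _ idfun).
have y_gt0 : 0 < (a * (a + 1))%:Z by nia.
rewrite is_odd_integerP // !hQ_consecutive intr_div_nat ?hQ_gt0 //.
rewrite intr_div_intP ?gt_eqF ?hQ_gt0 //.
exact: (@hQ_dvd_iff _ _ _ idfun).
Qed.
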